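(* Let $d\geq 2$. Assume $\mathcal{D}\subset\mathbb{R}^d$ is bounded and convex and contains the cube $[0,\epsilon)^d$ for some $\epsilon>0$. If $\alpha=(\alpha_1,\ldots,\alpha_d)\in\mathbb{R}^d$ is such that \[\sup_{T_1,\ldots,T_d\geq 1} G(\alpha,\mathcal{D}_T)=\infty,\] then \[\liminf_{n\to\infty} n\,\|n\alpha_1\|_{\mathbb{R}/\mathbb{Z}}\cdots\|n\alpha_d\|_{\mathbb{R}/\mathbb{Z}}=0.\]
   Context: For a bounded set $\mathcal{D}\subset\mathbb{R}^d$ and $\alpha\in\mathbb{R}^d$, let $S(\alpha,\mathcal{D})=\{m\cdot\alpha \bmod 1 \mid m\in\mathbb{Z}^d\cap\mathcal{D}\}\subset\mathbb{R}/\mathbb{Z}$, and let $G(\alpha,\mathcal{D})$ be the number of distinct lengths of the gaps between consecutive elements of $S(\alpha,\mathcal{D})$ on the circle $\mathbb{R}/\mathbb{Z}$. For $T=\operatorname{diag}(T_1,\ldots,T_d)$ with $T_i>0$, $\mathcal{D}_T=\{xT\mid x\in\mathcal{D}\}$ (with $x$ a row vector). $\|x\|_{\mathbb{R}/\mathbb{Z}}$ denotes the distance from $x$ to the nearest integer. *)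

(* Defs.v *)
From HB Require Import structures.
From mathcomp Require Import all_boot all_order all_algebra.
From mathcomp Require Import all_classical all_reals all_analysis.
From mathcomp Require Import finmap.
Set Implicit Arguments. Unset Strict Implicit. Unset Printing Implicit Defensive.
Import Order.TTheory GRing.Theory Num.Theory.
Local Open Scope classical_set_scope.
Local Open Scope ring_scope.

Section Defs.
Variable R : realType.
Variable d : nat.

Definition vecR := 'I_d -> R.

Definition frac (x : R) : R := x - (Num.floor x)%:~R.

Definition distZ (x : R) : R := Num.min (frac x) (1 - frac x).

Definition boundedD (D : set vecR) : Prop :=
  exists M : R, forall x, D x -> forall i, `|x i| <= M.

Definition convexD (D : set vecR) : Prop :=
  forall x y, D x -> D y -> forall t : R, 0 <= t -> t <= 1 ->
    D (fun i => t * x i + (1 - t) * y i).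

Definition scaleD (D : set vecR) (T : vecR) : set vecR :=
  [set y | exists2 x, D x & y = (fun i => x i * T i)].

Definition dotZ (m : 'I_d -> int) (a : vecR) : R :=
  \sum_(i < d) (m i)%:~R * a i.

(* S(alpha, D) as a subset of [0,1) (representatives of R/Z) *)
Definition Sset (a : vecR) (D : set vecR) : set R :=
  [set frac (dotZ m a) | m in [set m : 'I_d -> int | D (fun i => (m i)%:~R)]].

(* forward distance on the circle from s to s', in (0,1];
   it is 1 when s' = s (mod 1) *)
Definition fwd (s s' : R) : R := if frac (s' - s) == 0 then 1 else frac (s' - s).

Definition is_gap (S : set R) (s g : R) : Prop :=
  S s /\ (exists2 s', S s' & fwd s s' = g) /\ (forall s', S s' -> g <= fwd s s').

Definition gap_lengths (S : set R) : set R := [set g | exists s, is_gap S s g].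

Definition Gaps (a : vecR) (D : set vecR) : nat := (#|` fset_set (gap_lengths (Sset a D)) |)%fset.

End Defs.

(* Main.v *)
From mathcomp Require Import all_boot all_order all_algebra.
From mathcomp Require Import all_classical all_reals all_analysis.
From mathcomp Require Import finmap ring lra zify.
Require Import Defs.
Set Implicit Arguments. Unset Strict Implicit. Unset Printing Implicit Defensive.
Import Order.TTheory GRing.Theory Num.Theory.
Local Open Scope classical_set_scope.
Local Open Scope ring_scope.

(* Suppose the liminf is positive, so that q ||q a_1|| ... ||q a_d|| >= c > 0 for
   all q >= 1.  Let T_i >= 1, let P be the product of the T_i, and call a form
   y = k.a + n "short" if |k_i| <= eta T_i and |y| <= 1 / (2^(d+1) P).  For small
   eta there is no nontrivial short form: Dirichlet's theorem gives q >= 1 and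
   integers p_i with u_i = p_i - q a_i so small that the integer
   k.p + q n = k.u + q y has absolute value < 1, hence vanishes; then
   |q y| = |k.u| is small, and q |u_1 ... u_d| < c.

   Two consequences: the points x.a with x in a box of sides ~ T_i are separated
   on the circle at scale 1/P, and a packing argument shows that finitely many
   (independently of T) translates of such a box reach every point of the circle.
   The latter, applied to the cube contained in D, bounds every gap by B/P; the
   former leaves only boundedly many possible gap lengths below B/P. *)

(** * Fractional parts and the distance to the nearest integer *)

Lemma frac_itv (R : realType) (x : R) : 0 <= frac x < 1.
Proof.
rewrite /frac subr_ge0 floor_le /= ltrBlDr addrC.
by have := floorD1_gt x; rewrite intrD.
Qed.

Lemma distZ_ge0 (R : realType) (x : R) : 0 <= distZ x.
Proof. by have /andP[? ?] := frac_itv x; rewrite /distZ le_min; lra. Qed.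

Lemma distZ_le (R : realType) (x : R) (p : int) : distZ x <= `|x - p%:~R|.
Proof.
have := frac_itv x; rewrite /distZ /frac; set f := Num.floor x => /andP[f0 f1].
rewrite ge_min; case: (lerP p f) => pf.
  have : p%:~R <= f%:~R :> R by rewrite ler_int.
  by move=> pf'; apply/orP; left; rewrite ger0_norm; lra.
have : (f + 1)%:~R <= p%:~R :> R by rewrite ler_int; lia.
rewrite intrD => pf'; apply/orP; right; rewrite ler0_norm; lra.
Qed.

Lemma distZ_attained (R : realType) (x : R) :
  exists p : int, distZ x = `|x - p%:~R|.
Proof.
have := frac_itv x; rewrite /distZ /frac; set f := Num.floor x => /andP[f0 f1].
case: (lerP (x - f%:~R) (1 - (x - f%:~R))) => h.
  by exists f; rewrite ger0_norm.
by exists (f + 1); rewrite intrD ler0_norm; lra.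
Qed.

Lemma distZ_natmul (R : realType) (n : nat) (x : R) :
  distZ (n%:R * x) <= n%:R * distZ x.
Proof.
have [p ->] := distZ_attained x.
apply: le_trans (distZ_le _ (n%:Z * p)) _.
by rewrite intrM -mulrBr normrM ger0_norm.
Qed.

(** * Pigeonhole and Dirichlet's theorem *)

Lemma truncn_eq_dist (R : realType) (x y : R) :
  0 <= x -> 0 <= y -> Num.truncn x = Num.truncn y -> `|x - y| < 1.
Proof.
move=> x0 y0 e; have := truncn_itv x0; have := truncn_itv y0.
rewrite -e -natr1 => /andP[a1 a2] /andP[b1 b2].
by rewrite ltr_norml; lra.
Qed.

Lemma card_dffun_ord (d : nat) (N : 'I_d -> nat) :
  #|{dffun forall i : 'I_d, 'I_(N i)}| = (\prod_(i < d) N i)%N.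
Proof.
rewrite card_dep_ffun foldrE big_map big_enum /=.
by apply: eq_bigr => i _; rewrite card_ord.
Qed.

Lemma pigeonhole (A B : finType) (f : A -> B) :
  (#|B| < #|A|)%N -> exists x y, x != y /\ f x = f y.
Proof.
move=> BA; have /injectivePn [x [y xy fxy]] : ~~ injectiveb f.
  by apply/negP => /injectiveP /leq_card; rewrite leqNgt BA.
by exists x, y.
Qed.

(** Mod 1, one more multiple [t a] than there are boxes with sides [1 / N i] forces two into one
    box; their difference gives [q] and [p]. *)
Lemma dirichlet_nat (R : realType) (d : nat) (a : vecR R d) (N : 'I_d -> nat) :
  (forall i, 0 < N i)%N ->
  exists (q : nat) (p : 'I_d -> int), [/\ (0 < q)%N, (q <= \prod_(i < d) N i)%N &
    forall i, `|(p i)%:~R - q%:R * a i| < (N i)%:R^-1].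
Proof.
move=> N0.
pose x (t : nat) i : R := frac (t%:R * a i) * (N i)%:R.
have x0 t i : 0 <= x t i by rewrite mulr_ge0//; case/andP: (frac_itv (t%:R * a i)).
have cellP t i : (Num.truncn (x t i) < N i)%N.
  rewrite truncn_lt_nat// -[ltRHS]mul1r ltr_pM2r ?ltr0n//.
  by case/andP: (frac_itv (t%:R * a i)).
pose cell (t : 'I_(\prod_(i < d) N i).+1) : {dffun forall i : 'I_d, 'I_(N i)} :=
  [ffun i => Ordinal (cellP t i)].
have [|t1 [t2 [t12 cell12]]] := @pigeonhole _ _ cell.
  by rewrite card_dffun_ord card_ord.
wlog lt12 : t1 t2 t12 cell12 / (t1 < t2)%N.
  move=> wl; case: (ltngtP t1 t2) => [||/val_inj] h.
  - exact: wl h.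
  - by apply: wl h => //; rewrite eq_sym.
  - by rewrite h eqxx in t12.
exists (t2 - t1)%N, (fun i => Num.floor (t2%:R * a i) - Num.floor (t1%:R * a i)).
split; first by rewrite subn_gt0.
  by apply: leq_trans (leq_subr _ _) _; rewrite -ltnS.
move=> i; have := congr1 (fun g : {dffun forall i : 'I_d, 'I_(N i)} => val (g i)) cell12.
rewrite !ffunE /= => /(truncn_eq_dist (x0 _ _) (x0 _ _)).
rewrite /x -mulrBl normrM (ger0_norm (ler0n _ _)) -ltr_pdivlMr ?ltr0n// mul1r.
rewrite /frac natrB ?(ltnW lt12)// intrB.
by congr (_ < _); congr `|_|; ring.
Qed.

(** Rounding each [W i] up to an integer at most [2 * W i] costs the factor [2 ^+ d]. *)
Lemma dirichlet (R : realType) (d : nat) (a W : vecR R d) :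
  (forall i, 1 <= W i) ->
  exists (q : nat) (p : 'I_d -> int),
    [/\ (0 < q)%N, q%:R <= 2 ^+ d * \prod_(i < d) W i &
      forall i, `|(p i)%:~R - q%:R * a i| <= (W i)^-1].
Proof.
move=> W1.
have [//|q [p [q0 qN pP]]] := @dirichlet_nat R d a (fun i => (Num.truncn (W i)).+1).
exists q, p; split => //.
  apply: (@le_trans _ _ (\prod_(i < d) (2 * W i))); last first.
    by rewrite big_split /= prodr_const card_ord.
  rewrite -(ler_nat R) in qN; apply: le_trans qN _.
  rewrite natr_prod; apply: ler_prod => i _; rewrite ler0n /=.
  have W0 : 0 <= W i by apply: le_trans (W1 i).
  have /andP[h _] := truncn_itv W0.
  by have := W1 i; rewrite -natr1; lra.
move=> i; apply/ltW/(lt_le_trans (pP i)).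
rewrite lef_pV2 ?posrE ?ltr0n//; last by apply: lt_le_trans (W1 i).
exact/ltW/truncnS_gt.
Qed.

(** * Transference: short forms against simultaneous approximation *)

Lemma dual_pairing (R : realType) (d : nat) (a : vecR R d) (k p : 'I_d -> int)
    (n : int) (q : nat) :
  \sum_(i < d) (k i)%:~R * ((p i)%:~R - q%:R * a i) + q%:R * (dotZ k a + n%:~R)
  = (\sum_(i < d) k i * p i + q%:Z * n)%:~R :> R.
Proof.
rewrite intrD intrM mulrDr addrA; congr (_ + _).
rewrite /dotZ mulr_sumr -big_split /= raddf_sum /=.
by apply: eq_bigr => i _; rewrite intrM; ring.
Qed.

(** Here [|k.u| <= d eta < 1/2] and [|q y| <= 1/2], so the integer of [dual_pairing] has absolute
    value below 1. *)
Lemma dual_approx (R : realType) (d : nat) (a W : vecR R d) (k : 'I_d -> int)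
    (n : int) (eta : R) :
  (forall i, 1 <= W i) -> (forall i, `|(k i)%:~R| <= eta * W i) ->
  d%:R * eta < 2^-1 ->
  2 ^+ d * (\prod_(i < d) W i) * `|dotZ k a + n%:~R| <= 2^-1 ->
  exists (q : nat) (p : 'I_d -> int),
    [/\ (0 < q)%N, q%:R <= 2 ^+ d * \prod_(i < d) W i,
      forall i, `|(p i)%:~R - q%:R * a i| <= (W i)^-1 &
      \sum_(i < d) (k i)%:~R * ((p i)%:~R - q%:R * a i)
        = - (q%:R * (dotZ k a + n%:~R))].
Proof.
move=> W1 kW eta2 y2; have [q [p [q0 qW pP]]] := dirichlet a W1.
exists q, p; split => //; apply/eqP; rewrite -subr_eq0 opprK dual_pairing.
set P := (\sum_(i < d) _ + _)%R; suff: P = 0 by move=> ->.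
have : `|P%:~R| < 1 :> R.
  rewrite -(dual_pairing a); apply: le_lt_trans (ler_normD _ _) _.
  rewrite [ltRHS](_ : _ = 2^-1 + 2^-1); last lra.
  apply: ltr_leD; last first.
    rewrite normrM (ger0_norm (ler0n _ _)); apply: le_trans _ y2.
    by apply: ler_wpM2r.
  apply: le_lt_trans (ler_norm_sum _ _ _) _; apply: le_lt_trans _ eta2.
  rewrite -[in leRHS](card_ord d) mulr_natl -sumr_const; apply: ler_sum => i _.
  have Wi0 : 0 < W i by apply: lt_le_trans (W1 i).
  rewrite normrM; apply: (@le_trans _ _ (eta * W i * (W i)^-1)).
    by apply: ler_pM.
  by rewrite mulfK// gt_eqF.
by rewrite -intr_norm (_ : 1 = 1%:~R)// ltr_int; lia.
Qed.

Definition badly_approx (R : realType) (d : nat) (a : vecR R d) (c : R) :=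
  forall q : nat, (0 < q)%N -> c <= q%:R * \prod_(i < d) distZ (q%:R * a i).

Lemma badly_approx_le (R : realType) (d : nat) (a : vecR R d) (c : R)
    (q : nat) (p : 'I_d -> int) :
  badly_approx a c -> (0 < q)%N ->
  c <= q%:R * \prod_(i < d) `|(p i)%:~R - q%:R * a i|.
Proof.
move=> bad q0; apply: le_trans (bad q q0) _; apply: ler_wpM2l => //.
by apply: ler_prod => i _; rewrite distZ_ge0 distrC distZ_le.
Qed.

(** If the form were short, stretching the sides to product [1 / (2^(d+1) |y|)] would give
    [q |y| <= d eta] and [|u_1 ... u_d| <= 2^(d+1) |y|], hence
    [q |u_1 ... u_d| <= 2^(d+1) d eta < c]. *)
Lemma form_neq0_lower_bound (R : realType) (d : nat) (a T : vecR R d) (c eta : R)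
    (k : 'I_d -> int) (n : int) (j : 'I_d) :
  badly_approx a c -> (forall i, 1 <= T i) ->
  0 <= eta -> d%:R * eta < 2^-1 -> 2 ^+ d.+1 * (d%:R * eta) < c ->
  (forall i, `|(k i)%:~R| <= eta * T i) ->
  dotZ k a + n%:~R != 0 ->
  (2 ^+ d.+1 * \prod_(i < d) T i)^-1 < `|dotZ k a + n%:~R|.
Proof.
move=> bad T1 eta0 eta2 etac kT y0; rewrite ltNge; apply/negP => yle.
set y := dotZ k a + n%:~R in y0 yle.
have T0 i : 0 < T i by apply: lt_le_trans (T1 i).
have PT0 : 0 < \prod_(i < d) T i by apply: prodr_gt0.
have C0 : 0 < 2 ^+ d.+1 :> R by rewrite exprn_gt0.
have ny0 : 0 < `|y| by rewrite normr_gt0.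
(* Stretching one side by [L] makes [2 ^+ d * \prod W * `|y|] equal to 1/2. *)
pose L := (2 ^+ d.+1 * `|y| * \prod_(i < d) T i)^-1.
have L1 : 1 <= L.
  rewrite invf_ge1 ?mulr_gt0//; move: yle.
  by rewrite -[_^-1]mul1r ler_pdivlMr ?mulr_gt0// mulrCA mulrA.
pose W i := T i * (if i == j then L else 1).
have W1 i : 1 <= W i.
  by rewrite /W; case: eqP => _; rewrite -[leLHS]mulr1 ler_pM.
have TW i : T i <= W i.
  by rewrite -[leLHS]mulr1 /W; case: eqP => _; rewrite ler_wpM2l// ltW.
have PW : \prod_(i < d) W i = (2 ^+ d.+1 * `|y|)^-1.
  rewrite big_split /= [X in _ * X](bigD1 j)//= eqxx.
  rewrite [X in L * X]big1 ?mulr1; last by move=> i /negbTE ->.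
  by rewrite /L; field; rewrite !gt_eqF.
have [||q [p [q0 qW pW]]] := dual_approx (k := k) (n := n) W1 _ eta2 (a := a).
- by move=> i; apply: le_trans (kT i) _; rewrite ler_wpM2l.
- rewrite PW -/y le_eqVlt; apply/orP; left; apply/eqP.
  by rewrite exprS; field; rewrite !gt_eqF// exprn_gt0.
rewrite -/y => kp.
have qy : q%:R * `|y| <= d%:R * eta.
  rewrite -[X in X * _](ger0_norm (ler0n _ _)) -normrM -normrN -kp.
  apply: le_trans (ler_norm_sum _ _ _) _.
  rewrite -[in leRHS](card_ord d) mulr_natl -sumr_const; apply: ler_sum => i _.
  have Wi0 : 0 < W i by apply: lt_le_trans (W1 i).
  rewrite normrM; apply: (@le_trans _ _ (eta * W i * (W i)^-1)).
    apply: ler_pM => //; apply: le_trans (kT i) _; exact: ler_wpM2l.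
  by rewrite mulfK// gt_eqF.
have := badly_approx_le p bad q0.
have pP : \prod_(i < d) `|(p i)%:~R - q%:R * a i| <= 2 ^+ d.+1 * `|y|.
  rewrite -[leRHS]invrK -PW -prodfV; apply: ler_prod => i _.
  by rewrite normr_ge0 pW.
move=> /le_trans/(_ (ler_wpM2l (ler0n _ _) pP)).
rewrite mulrCA => cle; have := le_trans cle (ler_wpM2l (ltW C0) qy).
by rewrite leNgt etac.
Qed.

(** A vanishing form puts no limit on the sides, so all but the [j]-th are stretched by a large [L].
    Then [k_j u_j] is minus the sum of the other terms, each at most [eta / L], so [u_j] is small as
    well. *)
Lemma form_eq0_false (R : realType) (d : nat) (a T : vecR R d) (c eta : R)
    (k : 'I_d -> int) (n : int) (j : 'I_d) :
  0 < c -> badly_approx a c -> (forall i, 1 <= T i) ->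
  0 <= eta -> d%:R * eta < 2^-1 ->
  (forall i, `|(k i)%:~R| <= eta * T i) ->
  k j != 0 -> dotZ k a + n%:~R <> 0.
Proof.
move=> c0 bad T1 eta0 eta2 kT kj y0.
have T0 i : 0 < T i by apply: lt_le_trans (T1 i).
(* The bound obtained for [q |u_1 ... u_d|] is [c * K / L], so any [L > K] gives a contradiction. *)
pose K := 2 ^+ d * T j * (d%:R * eta) / c.
have K0 : 0 <= K by rewrite !mulr_ge0 ?invr_ge0 ?exprn_ge0// ltW.
pose L := K + 1.
have L1 : 1 <= L by rewrite /L; lra.
have L0 : 0 < L by apply: lt_le_trans L1.
pose W i := T i * (if i == j then 1 else L).
have W1 i : 1 <= W i.
  by rewrite /W; case: eqP => _; rewrite -[leLHS]mulr1 ler_pM.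
have TW i : T i <= W i.
  by rewrite -[leLHS]mulr1 /W; case: eqP => _; rewrite ler_wpM2l// ltW.
have [||q [p [q0 qW pW]]] := dual_approx (k := k) (n := n) W1 _ eta2 (a := a).
- by move=> i; apply: le_trans (kT i) _; rewrite ler_wpM2l.
- by rewrite y0 normr0 mulr0.
rewrite y0 mulr0 oppr0 (bigD1 j)//= => /eqP; rewrite addr_eq0 => /eqP kpj.
have pj : `|(p j)%:~R - q%:R * a j| <= d%:R * eta / L.
  apply: (@le_trans _ _ (`|(k j)%:~R| * `|(p j)%:~R - q%:R * a j|)).
    rewrite ler_peMl// -intr_norm (_ : 1 = 1%:~R)// ler_int; lia.
  rewrite -normrM kpj normrN; apply: le_trans (ler_norm_sum _ _ _) _.
  rewrite -mulrA -[in leRHS](card_ord d) mulr_natl -sumr_const.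
  rewrite [leRHS](bigD1 j)//= -[leLHS]add0r lerD ?mulr_ge0 ?invr_ge0 ?(ltW L0)//.
  apply: ler_sum => i /negbTE ij.
  have Wi0 : 0 < W i by apply: lt_le_trans (W1 i).
  rewrite normrM; apply: (@le_trans _ _ (eta * T i * (W i)^-1)).
    by apply: ler_pM.
  by rewrite /W ij invfM mulrA mulfK// gt_eqF.
have := badly_approx_le p bad q0; rewrite leNgt => /negP; apply.
have PW0 : 0 < \prod_(i < d | i != j) W i.
  by apply: prodr_gt0 => i _; apply: lt_le_trans (W1 i).
apply: (@le_lt_trans _ _ ((2 ^+ d * \prod_(i < d) W i) *
    (d%:R * eta / L * (\prod_(i < d | i != j) W i)^-1))).
  apply: ler_pM => //; first exact: prodr_ge0.
  rewrite (bigD1 j)//=; apply: ler_pM => //; first exact: prodr_ge0.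
  by rewrite -prodfV; apply: ler_prod => i _; rewrite normr_ge0 pW.
rewrite (bigD1 j)//= {1}/W eqxx mulr1.
rewrite [ltLHS](_ : _ = K / L * c); last first.
  by rewrite /K; field; rewrite !gt_eqF.
by rewrite -[ltRHS]mul1r ltr_pM2r// ltr_pdivrMr// mul1r /L; lra.
Qed.

(** The disjunction serves two uses: distinct gap lengths supply a nonzero value, distinct points of
    a box a nonzero [k]. *)
Lemma form_separation (R : realType) (d : nat) (a T : vecR R d) (c eta : R)
    (k : 'I_d -> int) (n : int) :
  (0 < d)%N -> 0 < c -> badly_approx a c -> (forall i, 1 <= T i) ->
  0 <= eta -> d%:R * eta < 2^-1 -> 2 ^+ d.+1 * (d%:R * eta) < c ->
  (forall i, `|(k i)%:~R| <= eta * T i) ->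
  dotZ k a + n%:~R != 0 \/ (exists j, k j != 0) ->
  (2 ^+ d.+1 * \prod_(i < d) T i)^-1 < `|dotZ k a + n%:~R|.
Proof.
move=> d0 c0 bad T1 eta0 eta2 etac kT kn.
have [y0|y0] := eqVneq (dotZ k a + n%:~R) 0; last first.
  exact: form_neq0_lower_bound (Ordinal d0) bad T1 eta0 eta2 etac kT y0.
case: kn => [|[j kj]]; first by rewrite y0 eqxx.
by case: (form_eq0_false c0 bad T1 eta0 eta2 kT kj y0).
Qed.

(** * Covering the circle by sums of boxes *)

Lemma eqr_le (R : realType) (x y : R) : x = y -> x <= y.
Proof. by move=> ->. Qed.

Lemma dotZD (R : realType) (d : nat) (a : vecR R d) (x y : 'I_d -> int) :
  dotZ (fun i => x i + y i) a = dotZ x a + dotZ y a.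
Proof. by rewrite /dotZ -big_split; apply: eq_bigr => i _; rewrite intrD mulrDl. Qed.

Lemma dotZN (R : realType) (d : nat) (a : vecR R d) (x : 'I_d -> int) :
  dotZ (fun i => - x i) a = - dotZ x a.
Proof. by rewrite /dotZ -sumrN; apply: eq_bigr => i _; rewrite intrN mulNr. Qed.

Lemma dotZB (R : realType) (d : nat) (a : vecR R d) (x y : 'I_d -> int) :
  dotZ (fun i => x i - y i) a = dotZ x a - dotZ y a.
Proof. by rewrite dotZD dotZN. Qed.

(** For [t = 0, s, 2s, ...] the values form an integer path from 0 to [x] with steps at most [s], in
    place of a segment. *)
Definition clamp (t : nat) (x : int) : int := Num.max (- t%:Z) (Num.min t%:Z x).

Lemma clamp_norm (t : nat) (x : int) : `|clamp t x| <= t%:Z.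
Proof.
rewrite /clamp ler_norml le_max lexx /= ge_max ge_min lexx /=.
by rewrite andbT; lia.
Qed.

Lemma clamp_dist (t h : nat) (x : int) :
  (t <= h)%N -> `|x| <= h%:Z -> `|x - clamp t x| <= (h - t)%N%:Z.
Proof.
rewrite /clamp => th xh; case: (lerP t%:Z x) => tx.
  case: (lerP (- t%:Z) t); lia.
case: (lerP (- t%:Z) x); lia.
Qed.

Lemma ord_dist (s : nat) (u v : 'I_s.+1) : `|(u : nat)%:Z - (v : nat)%:Z| <= s%:Z.
Proof. by case: u v => [u us] [v vs] /=; lia. Qed.

(* [b] lies, mod 1, in the h-fold sum of the image [{x.a + y}] of the box
   [|x i| <= s i], [|y| <= delta]. *)
Definition box_reach (R : realType) (d : nat) (a : vecR R d) (s : 'I_d -> nat)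
    (delta : R) (h : nat) (b : R) :=
  exists (x : 'I_d -> int) (n : int), (forall i, `|x i| <= (h * s i)%N%:Z) /\
    `|b - dotZ x a - n%:~R| <= h%:R * delta.

Lemma box_reachD (R : realType) (d : nat) (a : vecR R d) s delta h1 h2 b1 b2 :
  box_reach a s delta h1 b1 -> box_reach a s delta h2 b2 ->
  box_reach a s delta (h1 + h2) (b1 + b2).
Proof.
move=> [x1 [n1 [x1P n1P]]] [x2 [n2 [x2P n2P]]].
exists (fun i => x1 i + x2 i), (n1 + n2); split.
  move=> i; apply: le_trans (ler_normD _ _) _.
  by rewrite mulnDl PoszD lerD.
rewrite dotZD intrD natrD mulrDl; apply: le_trans (lerD n1P n2P).
by apply: le_trans (ler_normD _ _); apply: eqr_le; congr `|_|; ring.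
Qed.

Lemma box_reachN (R : realType) (d : nat) (a : vecR R d) s delta h b :
  box_reach a s delta h b -> box_reach a s delta h (- b).
Proof.
move=> [x [n [xP nP]]]; exists (fun i => - x i), (- n); split.
  by move=> i; rewrite normrN.
by rewrite dotZN intrN -!opprD normrN.
Qed.

Lemma box_reachS (R : realType) (d : nat) (a : vecR R d) s delta h h' b :
  0 <= delta -> (h <= h')%N ->
  box_reach a s delta h b -> box_reach a s delta h' b.
Proof.
move=> delta0 hh' [x [n [xP nP]]]; exists x, n; split.
  by move=> i; apply: le_trans (xP i) _; rewrite lez_nat leq_mul2r hh' orbT.
by apply: le_trans nP _; rewrite ler_wpM2r// ler_nat.
Qed.

Lemma circle_pigeonhole (R : realType) (A : finType) (w : A -> R) (delta : R) :
  0 < delta -> ((Num.truncn delta^-1).+1 < #|A|)%N ->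
  exists u v (n : int), u != v /\ `|w u - w v - n%:~R| <= delta.
Proof.
move=> delta0 cardA; pose x u := frac (w u) / delta.
have x0 u : 0 <= x u.
  by rewrite divr_ge0 ?(ltW delta0)//; case/andP: (frac_itv (w u)).
have cellP u : (Num.truncn (x u) < (Num.truncn delta^-1).+1)%N.
  rewrite ltnS; apply: le_truncn; rewrite ler_piMl ?invr_ge0 ?(ltW delta0)//.
  by case/andP: (frac_itv (w u)) => _ /ltW.
have [|u [v [uv xuv]]] := @pigeonhole _ _ (fun u => Ordinal (cellP u)).
  by rewrite card_ord.
exists u, v, (Num.floor (w u) - Num.floor (w v)); split => //.
have := truncn_eq_dist (x0 u) (x0 v) (congr1 val xuv).
rewrite /x -mulrBl normrM normfV (gtr0_norm delta0) ltr_pdivrMr// mul1r.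
move=> /ltW; apply: le_trans; apply: eqr_le; congr `|_|.
by rewrite /frac intrB; ring.
Qed.

(* If [b] is first reached after [h] boxes, a straight path to it visits points
   [z 0, z 2, z 4, ...] whose unit boxes are disjoint on the circle; each has
   measure bounded below, so [h] is bounded. *)
Lemma circle_covering (R : realType) (d : nat) (a : vecR R d) (c eta : R) :
  (0 < d)%N -> 0 < c -> badly_approx a c ->
  0 < eta -> d%:R * eta < 2^-1 -> 2 ^+ d.+1 * (d%:R * eta) < c ->
  exists2 H : nat, (0 < H)%N & forall T : vecR R d, (forall i, 1 <= T i) ->
    forall b, box_reach a (fun i => Num.truncn (eta * T i))
      (2 ^+ d.+1 * \prod_(i < d) T i)^-1 H b.
Proof.
move=> d0 c0 bad eta0 eta2 etac.
(* Then [m] boxes with more than [eta T_i] points per side outnumber the at most [2 * 2^(d+1) P]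
   cells of length [1 / (2^(d+1) P)]. *)
pose m := (Num.truncn (2 * 2 ^+ d.+1 / eta ^+ d : R)).+1.
have m_lt : 2 * 2 ^+ d.+1 < m%:R * eta ^+ d.
  by rewrite -ltr_pdivrMr ?exprn_gt0// truncnS_gt.
exists (2 * m)%N => // T T1 b.
have T0 i : 0 < T i by apply: lt_le_trans (T1 i).
set s := fun i => _; set delta := (_ * _)^-1.
have PT1 : 1 <= \prod_(i < d) T i.
  apply: (@le_trans _ _ (\prod_(i < d) 1)); first by rewrite big1_eq.
  by apply: ler_prod => i _; rewrite ler01 T1.
have PT0 : 0 < \prod_(i < d) T i by apply: lt_le_trans PT1.
have C0 : 0 < 2 ^+ d.+1 :> R by rewrite exprn_gt0.
have C1 : 1 <= 2 ^+ d.+1 :> R by rewrite exprn_ege1// ler1n.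
have delta0 : 0 < delta by rewrite invr_gt0 mulr_gt0.
apply: contrapT => nreach.
(* With [x = 0], the real side alone reaches [b] once [h * delta >= |b|]. *)
have reach_b : exists h, `[< box_reach a s delta h b >].
  exists (Num.truncn (`|b| / delta)).+1; apply/asboolP.
  exists (fun=> 0), 0; split; first by move=> i; rewrite normr0.
  rewrite [dotZ _ _]big1 ?subr0; last by move=> i _; rewrite mul0r.
  by rewrite -ler_pdivrMr// ltW// truncnS_gt.
case: (ex_minnP reach_b) => h /asboolP reach_h h_min.
have mh : (2 * m < h)%N.
  rewrite ltnNge; apply/negP => hm; apply: nreach.
  exact: box_reachS (ltW delta0) hm reach_h.
have h0 : 0 < h%:R :> R by rewrite ltr0n; apply: leq_ltn_trans mh.
case: reach_h => x [n [xP yP]]; set y := b - _ - _ in yP.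
(* The path [z] goes from 0 to [b] mod 1 in [h] steps: [x] is clamped and the real error [y] is
   spread evenly. *)
pose xc (t : nat) i : int := clamp (t * s i) (x i).
pose z (t : nat) : R := dotZ (xc t) a + y * (t%:R / h%:R).
have yt (t : nat) : `|y * (t%:R / h%:R)| <= t%:R * delta.
  rewrite normrM [X in _ * X]ger0_norm ?divr_ge0//.
  rewrite mulrCA ler_wpM2l// ler_pdivrMr// mulrC.
  by rewrite mulrC [leRHS]mulrC.
have reach_z t : box_reach a s delta t (z t).
  exists (xc t), 0; split; last by rewrite subr0 /z addrAC subrr add0r.
  by move=> i; apply: clamp_norm.
have reach_bz t : (t <= h)%N -> box_reach a s delta (h - t) (b - z t).
  move=> th; exists (fun i => x i - xc t i), n; split.
    by move=> i; rewrite mulnBl; apply: clamp_dist => //; rewrite leq_mul2r th orbT.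
  apply: le_trans (yt _); apply: eqr_le; congr `|_|.
  by rewrite dotZB natrB// /z /y; field; rewrite gt_eqF.
(* A single box between them would be a shortcut, reaching [b] after [t + 1 + (h - t') < h]
   boxes. *)
have z_far t t' : (t.+1 < t')%N -> (t' <= h)%N -> ~ box_reach a s delta 1 (z t' - z t).
  move=> tt' t'h /(box_reachD (reach_z t)) /box_reachD /(_ (reach_bz _ t'h)).
  rewrite [X in box_reach _ _ _ _ X](_ : _ = b); last by ring.
  by move=> /asboolP /h_min h_le; clear -tt' t'h h_le; lia.
pose A := ('I_m * {dffun forall i : 'I_d, 'I_(s i).+1})%type.
pose vec (g : {dffun forall i : 'I_d, 'I_(s i).+1}) i : int := (g i : nat)%:Z.
pose w (u : A) := z (2 * u.1)%N + dotZ (vec u.2) a.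
have [|[t g] [[t' g'] [r [neq wr]]]] := @circle_pigeonhole R A w delta delta0.
  rewrite card_prod card_ord card_dffun_ord -(ltr_nat R).
  apply: (@le_lt_trans _ _ (2 * 2 ^+ d.+1 * \prod_(i < d) T i)).
    have deltaV0 : 0 <= delta^-1 by rewrite invr_ge0 ltW.
    rewrite -natr1; have /andP[le_tr _] := truncn_itv deltaV0.
    apply: le_trans (lerD le_tr (lexx 1)) _; rewrite /delta invrK.
    have : 1 <= 2 ^+ d.+1 * \prod_(i < d) T i by rewrite -[leLHS]mulr1 ler_pM.
    by lra.
  rewrite natrM; apply: (@lt_le_trans _ _ (m%:R * eta ^+ d * \prod_(i < d) T i)).
    by rewrite ltr_pM2r.
  rewrite -mulrA ler_wpM2l// -[X in eta ^+ X](card_ord d) -prodr_const -big_split /=.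
  rewrite natr_prod; apply: ler_prod => i _; rewrite mulr_ge0 ?(ltW eta0) ?(ltW (T0 _))//=.
  exact/ltW/truncnS_gt.
have gs i : `|vec g' i - vec g i| <= (s i)%:Z.
  exact: ord_dist.
have reach1 : box_reach a s delta 1 (z (2 * t)%N - z (2 * t')%N).
  exists (fun i => vec g' i - vec g i), r; split; first by move=> i; rewrite mul1n.
  rewrite mul1r; apply: le_trans wr; apply: eqr_le; congr `|_|.
  by rewrite dotZB /w /=; ring.
(* Different indices contradict [z_far]; equal ones leave two distinct points of one box,
   contradicting [form_separation]. *)
have [tt'|tt'|/val_inj tt'] := ltngtP t t'.
- have t'm := ltn_ord t'.
  apply: (z_far (2 * t)%N (2 * t')%N); [clear -tt'; lia|clear -t'm mh; lia|].
  by rewrite -opprB; apply: box_reachN.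
- have tm := ltn_ord t.
  by apply: (z_far (2 * t')%N (2 * t)%N); [clear -tt'; lia|clear -tm mh; lia|].
have gg' : exists j, vec g j - vec g' j != 0.
  apply: contrapT => /forallNP eqg; move: neq; rewrite tt' => /eqP; apply.
  congr (_, _); apply/ffunP => i; apply/val_inj.
  have [e|/eqg//] := eqVneq (vec g i - vec g' i) 0.
  by move/eqP: e; rewrite subr_eq0 => /eqP /(congr1 absz).
have kT i : `|(vec g i - vec g' i)%:~R| <= eta * T i.
  have /andP[le_s _] := truncn_itv (mulr_ge0 (ltW eta0) (ltW (T0 i))).
  apply: le_trans le_s; rewrite -intr_norm distrC.
  rewrite -[leRHS]/((s i)%:Z%:~R) ler_int; exact: gs.
have := form_separation (n := - r) d0 c0 bad T1 (ltW eta0) eta2 etac kT (or_intror gg').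
rewrite -/delta ltNge => /negP; apply; apply: le_trans wr; apply: eqr_le; congr `|_|.
by rewrite dotZB intrN /w /= tt'; ring.
Qed.

(** * Gap lengths: upper bound and representation as forms *)

Lemma fwd_gt0 (R : realType) (s s' : R) : 0 < fwd s s'.
Proof.
rewrite /fwd; case: eqVneq => // f0; rewrite lt_neqAle eq_sym f0.
by case/andP: (frac_itv (s' - s)).
Qed.

Lemma fwd_int (R : realType) (s s' : R) : exists n : int, fwd s s' = s' - s + n%:~R.
Proof.
rewrite /fwd; case: eqP => [f0|_]; last by exists (- Num.floor (s' - s)); rewrite intrN.
exists (1 - Num.floor (s' - s)); move: f0; rewrite /frac intrB; lra.
Qed.

(** The value 1 at congruent points makes [fwd] the least positive representative mod 1. *)
Lemma fwd_le (R : realType) (s s' : R) (n : int) :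
  0 < s' - s + n%:~R -> fwd s s' <= s' - s + n%:~R.
Proof.
rewrite /fwd; have := frac_itv (s' - s); rewrite /frac; set f := Num.floor _.
move=> /andP[f0 f1] y0; have fn : 0 <= (f + n)%:~R :> R.
  have : - 1%:~R < (f + n)%:~R :> R by rewrite intrD; lra.
  by rewrite -intrN ltr_int ler0z; lia.
case: eqP => [e|_]; last by move: fn; rewrite intrD; lra.
have : 0%:~R < (f + n)%:~R :> R by rewrite intrD; lra.
have -> : s' - s + n%:~R = (f + n)%:~R by rewrite intrD; lra.
by rewrite ltr_int (_ : 1 = 1%:~R)// ler_int; lia.
Qed.

Lemma shift_norm_le (x h : int) : `|x| <= h -> 0 <= x + h <= 2 * h.
Proof. lia. Qed.

(** From the point [m.a] where the gap starts, [circle_covering] leads to a point [m'.a] slightly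
    ahead, with [m'] in the scaled cube; the gap is no longer than the way there. *)
Lemma gap_upper_bound (R : realType) (d : nat) (D : set (vecR R d)) (a : vecR R d)
    (c eta eps : R) :
  (0 < d)%N -> 0 < c -> badly_approx a c ->
  0 < eta -> d%:R * eta < 2^-1 -> 2 ^+ d.+1 * (d%:R * eta) < c ->
  0 < eps -> (forall x : vecR R d, (forall i, 0 <= x i < eps) -> D x) ->
  exists B : R, forall T : vecR R d, (forall i, 1 <= T i) ->
    forall g, gap_lengths (Sset a (scaleD D T)) g -> g * \prod_(i < d) T i <= B.
Proof.
move=> d0 c0 bad eta0 eta2 etac eps0 epsD.
have [H H0 cover] := circle_covering d0 c0 bad eta0 eta2 etac.
have eta1 : eta < 1.
  have : 1 <= d%:R :> R by rewrite ler1n.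
  by move: eta0 eta2 => ? ? ?; nra.
have HR : 0 < H%:R :> R by rewrite ltr0n.
(* The coordinates of [m'] are at most [2 H eta T' i], which is [eta eps T i < eps T i] when
   [T' i = kappa * T i]. *)
pose kappa := eps / (2 * H%:R).
have kappa0 : 0 < kappa by rewrite divr_gt0// mulr_gt0.
exists (3 * H%:R / (2 ^+ d.+1 * kappa ^+ d)) => T T1 g [s [[m _ <-] [_ gle]]].
have T0 i : 0 < T i by apply: lt_le_trans (T1 i).
(* Where [T' i = 1] the side [S i] below is 0, so the point [m'] has i-th
   coordinate 0; this keeps [m'] in the cube even when [T i] is small. *)
pose T' i := Num.max 1 (kappa * T i).
have T'1 i : 1 <= T' i by rewrite le_max lexx.
have T'0 i : 0 < T' i by apply: lt_le_trans (T'1 i).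
have PT0 : 0 < \prod_(i < d) T i by apply: prodr_gt0.
have PT'0 : 0 < \prod_(i < d) T' i by apply: prodr_gt0.
have C0 : 0 < 2 ^+ d.+1 :> R by rewrite exprn_gt0.
set delta := (2 ^+ d.+1 * \prod_(i < d) T' i)^-1.
have delta0 : 0 < delta by rewrite invr_gt0 mulr_gt0.
pose S i := Num.truncn (eta * T' i).
pose h i : int := (H * S i)%N%:Z.
(* The offset [2 H delta] turns the two-sided error [H delta] into a forward distance between
   [H delta] and [3 H delta]. Subtracting [h.a] is undone by [m' = x + h], whose coordinates are
   nonnegative. *)
have [x [n [xP eP]]] := cover T' T'1 (dotZ m a - dotZ h a + 2 * H%:R * delta).
pose m' i := x i + h i.
have m'P i : 0 <= (m' i)%:~R / T i < eps.
  have /andP[m'0 m'2h] := shift_norm_le (xP i).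
  rewrite divr_ge0 ?ler0z ?(ltW (T0 i))//= ltr_pdivrMr//.
  have m'u : (m' i)%:~R <= 2 * H%:R * (S i)%:R :> R.
    apply: (@le_trans _ _ (2 * h i)%:~R); first by rewrite ler_int.
    by rewrite intrM /h -mulrA -natrM.
  apply: le_lt_trans m'u _.
  have /andP[SeT _] := truncn_itv (mulr_ge0 (ltW eta0) (ltW (T'0 i))).
  have [kT|kT] := leP (kappa * T i) 1.
    have -> : S i = 0%N.
      by apply/truncn0Pn; rewrite -ltNge /T' (max_idPl _)// mulr1.
    by rewrite mulr0 mulr_gt0.
  have T'E : T' i = kappa * T i by rewrite /T' (max_idPr _)// ltW.
  apply: (@le_lt_trans _ _ (2 * H%:R * (eta * T' i))).
    by rewrite ler_wpM2l// mulr_ge0.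
  have -> : 2 * H%:R * (eta * T' i) = eta * (eps * T i).
    by rewrite T'E /kappa; field; rewrite gt_eqF.
  by rewrite -[ltRHS]mul1r ltr_pM2r// mulr_gt0.
have Sm' : Sset a (scaleD D T) (frac (dotZ m' a)).
  exists m' => //=; exists (fun i => (m' i)%:~R / T i); first exact: epsD.
  by apply/funext => i; rewrite divfK// gt_eqF.
pose r := n + Num.floor (dotZ m' a) - Num.floor (dotZ m a).
have yE : frac (dotZ m' a) - frac (dotZ m a) + r%:~R = 2 * H%:R * delta -
    (dotZ m a - dotZ h a + 2 * H%:R * delta - dotZ x a - n%:~R).
  by rewrite /frac /r !intrD intrN [dotZ m' a]dotZD; ring.
have Hd0 : 0 < H%:R * delta by rewrite mulr_gt0.
move: eP; rewrite -/delta ler_norml => /andP[el eu].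
have yl : 0 < frac (dotZ m' a) - frac (dotZ m a) + r%:~R by rewrite yE; lra.
have yu : frac (dotZ m' a) - frac (dotZ m a) + r%:~R <= 3 * H%:R * delta.
  by rewrite yE; lra.
have gy := le_trans (gle _ Sm') (le_trans (fwd_le yl) yu).
apply: le_trans (ler_wpM2r (ltW PT0) gy) _.
have PTT' : kappa ^+ d * \prod_(i < d) T i <= \prod_(i < d) T' i.
  rewrite -[X in kappa ^+ X](card_ord d) -prodr_const -big_split /=.
  apply: ler_prod => i _; rewrite mulr_ge0 ?(ltW kappa0) ?(ltW (T0 i))//=.
  by rewrite le_max lexx orbT.
rewrite /delta -!mulrA; do 2 apply: ler_wpM2l => //.
rewrite !invfM -mulrA ler_wpM2l ?invr_ge0 ?(ltW C0)//.
by rewrite mulrC ler_pdivrMr// mulrC ler_pdivlMr ?exprn_gt0// mulrC.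
Qed.

Lemma gap_repr (R : realType) (d : nat) (D : set (vecR R d)) (a T : vecR R d)
    (M g : R) :
  (forall x, D x -> forall i, `|x i| <= M) -> (forall i, 1 <= T i) ->
  gap_lengths (Sset a (scaleD D T)) g ->
  0 < g /\ exists (k : 'I_d -> int) (n : int),
    g = dotZ k a + n%:~R /\ forall i, `|(k i)%:~R| <= 2 * M * T i.
Proof.
move=> DM T1 [_ [[m [x Dx mx] <-] [[_ [m' [x' Dx' mx'] <-] <-] _]]].
split; first exact: fwd_gt0.
have [n ->] := fwd_int (frac (dotZ m a)) (frac (dotZ m' a)).
exists (fun i => m' i - m i), (n - Num.floor (dotZ m' a) + Num.floor (dotZ m a)).
split; first by rewrite dotZB /frac !intrD intrN; ring.
move=> i; rewrite intrB.
have := congr1 (fun f => f i) mx; have := congr1 (fun f => f i) mx'; move=> /= -> ->.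
rewrite -mulrBl normrM (ger0_norm (le_trans ler01 (T1 i))).
rewrite ler_wpM2r ?(le_trans ler01 (T1 i))//.
apply: le_trans (ler_normB _ _) _; have := DM _ Dx i; have := DM _ Dx' i; lra.
Qed.

(** * Counting the gap lengths *)

Lemma mem_fset_set (R : realType) (A : set R) (x : R) : x \in fset_set A -> A x.
Proof.
case: (pselect (finite_set A)) => fA; first by rewrite in_fset_set// => /set_mem.
(* For an infinite [A], [fset_set A] is empty by default. *)
by rewrite /fset_set; case: pselect.
Qed.

(** Gap lengths are forms with [|k_i| <= 2 M T_i] and value at most [B / P]. With these ranges cut
    into cells of size [eta T_i] and [1 / (2^(d+1) P)], two lengths in one cell would differ by a
    short nonzero form. *)
Lemma Gaps_bounded (R : realType) (d : nat) (D : set (vecR R d)) (a : vecR R d)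
    (c eps M : R) :
  (0 < d)%N -> 0 < c -> badly_approx a c ->
  (forall x, D x -> forall i, `|x i| <= M) ->
  0 < eps -> (forall x : vecR R d, (forall i, 0 <= x i < eps) -> D x) ->
  exists N : nat, forall T : vecR R d, (forall i, 1 <= T i) ->
    (Gaps a (scaleD D T) <= N)%N.
Proof.
move=> d0 c0 bad DM eps0 epsD.
have dR : 0 < d%:R :> R by rewrite ltr0n.
have C0 : 0 < 2 ^+ d.+1 :> R by rewrite exprn_gt0.
have [eta eta0 [eta2 etac]] : exists2 eta : R, 0 < eta &
    d%:R * eta < 2^-1 /\ 2 ^+ d.+1 * (d%:R * eta) < c.
  pose e := Num.min 4^-1 (c / 2 ^+ d.+1 / 2).
  have e0 : 0 < e by rewrite lt_min invr_gt0 ltr0n !divr_gt0.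
  exists (e / d%:R); first by rewrite divr_gt0.
  rewrite mulrCA divff ?gt_eqF// mulr1; split.
    by apply: (@le_lt_trans _ _ 4^-1); [rewrite ge_min lexx|lra].
  rewrite mulrC -ltr_pdivlMr//; apply: (@le_lt_trans _ _ (c / 2 ^+ d.+1 / 2)).
    by rewrite ge_min lexx orbT.
  have : 0 < c / 2 ^+ d.+1 by rewrite divr_gt0.
  by lra.
have [B gB] := gap_upper_bound d0 c0 bad eta0 eta2 etac eps0 epsD.
(* These count the cells in [[-2 M T_i, 2 M T_i]] and in [[0, B / P]]; [T] cancels from both. *)
pose A := (Num.truncn (4 * M / eta)).+1; pose E := (Num.truncn (2 ^+ d.+1 * B)).+1.
exists #|{: {ffun 'I_d -> 'I_A} * 'I_E}| => T T1.
have T0 i : 0 < T i by apply: lt_le_trans (T1 i).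
have PT0 : 0 < \prod_(i < d) T i by apply: prodr_gt0.
rewrite /Gaps cardfE; set F := fset_set _.
have FP (u : F) := mem_fset_set (fsvalP u).
have /choice[kn knP] : forall u : F, exists kn : ('I_d -> int) * int,
    fsval u = dotZ kn.1 a + kn.2%:~R /\ forall i, `|(kn.1 i)%:~R| <= 2 * M * T i.
  by move=> u; have [_ [k [n kn]]] := gap_repr DM T1 (FP u); exists (k, n).
pose X u i := (((kn u).1 i)%:~R + 2 * M * T i) / (eta * T i).
pose Y (u : F) := 2 ^+ d.+1 * (fsval u * \prod_(i < d) T i).
have X0 u i : 0 <= X u i.
  rewrite divr_ge0 ?mulr_ge0 ?(ltW eta0) ?(ltW (T0 i))//.
  by have := (knP u).2 i; rewrite ler_norml => /andP[]; lra.
have Y0 u : 0 <= Y u.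
  have [g0 _] := gap_repr DM T1 (FP u).
  by rewrite !mulr_ge0 ?(ltW C0) ?(ltW g0) ?(ltW PT0).
have XA u i : (Num.truncn (X u i) < A)%N.
  rewrite ltnS; apply: le_truncn; rewrite ler_pdivrMr ?mulr_gt0//.
  have -> : 4 * M / eta * (eta * T i) = 2 * M * T i + 2 * M * T i.
    by field; rewrite gt_eqF.
  by have := (knP u).2 i; rewrite ler_norml => /andP[]; lra.
have YE u : (Num.truncn (Y u) < E)%N.
  rewrite ltnS; apply: le_truncn; rewrite ler_wpM2l ?(ltW C0)//.
  exact: gB (FP u).
pose cell (u : F) : {ffun 'I_d -> 'I_A} * 'I_E :=
  ([ffun i => Ordinal (XA u i)], Ordinal (YE u)).
rewrite leqNgt; apply/negP => /(@pigeonhole _ _ cell)[u [v [uv]]].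
rewrite /cell => -[/ffunP eX eY].
have kT i : `|((kn u).1 i - (kn v).1 i)%:~R| <= eta * T i.
  have := eX i; rewrite !ffunE => /(congr1 val) /(truncn_eq_dist (X0 u i) (X0 v i)).
  rewrite /X -mulrBl normrM normfV (gtr0_norm (mulr_gt0 eta0 (T0 i))).
  rewrite ltr_pdivrMr ?mulr_gt0// mul1r => /ltW; apply: le_trans.
  by apply: eqr_le; congr `|_|; rewrite intrB; ring.
have yE : dotZ (fun i => (kn u).1 i - (kn v).1 i) a + ((kn u).2 - (kn v).2)%:~R =
    fsval u - fsval v.
  by rewrite dotZB intrB (knP u).1 (knP v).1; ring.
have y0 : fsval u - fsval v != 0.
  by rewrite subr_eq0; apply: contra uv => /eqP/val_inj ->.
have := form_separation (n := (kn u).2 - (kn v).2) d0 c0 bad T1 (ltW eta0) eta2 etac kT.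
rewrite yE => /(_ (or_introl y0)); rewrite ltNge => /negP; apply.
have := truncn_eq_dist (Y0 u) (Y0 v) eY.
rewrite /Y -mulrBr -mulrBl mulrCA normrM (gtr0_norm (mulr_gt0 C0 PT0)).
by rewrite -ltr_pdivlMr ?mulr_gt0// mul1r => /ltW.
Qed.

(** * From the liminf to bad approximability *)

Lemma limn_einf_gt0 (R : realType) (u : nat -> R) :
  (forall n, 0 <= u n) -> limn_einf (fun n => (u n)%:E) <> 0%E ->
  exists (c : R) (N : nat), 0 < c /\ forall n, (N <= n)%N -> c <= u n.
Proof.
move=> u0; rewrite limn_einf_lim => lim0; apply: contrapT => noc; apply: lim0.
apply/eqP; rewrite eq_le; apply/andP; split.
  apply: lime_le; first exact: is_cvg_einfs.
  apply: nearW => N; rewrite leNgt; apply/negP => inf0; apply: noc.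
  have infle n : (N <= n)%N -> (einfs (fun n => (u n)%:E) N <= (u n)%:E)%E.
    by move=> Nn; apply: ereal_inf_lbound; exists n.
  (* The infimum cannot be [+oo], since it is at most [u N]. *)
  move: inf0 infle; case: (einfs _ N) => [c|//|//] c0 cle; last first.
    by have := cle _ (leqnn N).
  by exists c, N; split => [|n /cle]; [rewrite -lte_fin|rewrite lee_fin].
apply: lime_ge; first exact: is_cvg_einfs.
apply: nearW => N; apply: le_ereal_inf_tmp => _ [n _ <-].
by rewrite lee_fin.
Qed.

(** The multiple [(N+1) q] lies beyond [N], and [||(N+1) x|| <= (N+1) ||x||] in each factor;
    together this loses [(N+1)^(d+1)]. *)
Lemma badly_approx_of_eventually (R : realType) (d : nat) (a : vecR R d) (c : R) (N : nat) :
  0 < c -> (forall n, (N <= n)%N -> c <= n%:R * \prod_(i < d) distZ (n%:R * a i)) ->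
  badly_approx a (c / N.+1%:R ^+ d.+1).
Proof.
move=> c0 cN q q0; rewrite ler_pdivrMr ?exprn_gt0 ?ltr0n//.
apply: le_trans (cN (N.+1 * q)%N _) _.
  by rewrite (leq_trans (leqnSn N))// leq_pmulr.
rewrite natrM exprS.
rewrite [leRHS](_ : _ = N.+1%:R * q%:R * (N.+1%:R ^+ d * \prod_(i < d) distZ (q%:R * a i)));
  last by ring.
rewrite ler_wpM2l ?mulr_ge0// -[X in _ ^+ X](card_ord d) -prodr_const -big_split /=.
by apply: ler_prod => i _; rewrite distZ_ge0 -mulrA distZ_natmul.
Qed.

Theorem theorem1p3 (R : realType) (d : nat) (D : set (vecR R d)) (a : vecR R d) :
  (2 <= d)%N ->
  boundedD D -> convexD D ->
  (exists2 eps : R, 0 < eps &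
     forall x : vecR R d, (forall i, 0 <= x i < eps) -> D x) ->
  (forall N : nat, exists T : vecR R d,
     (forall i, 1 <= T i) /\ (N <= Gaps a (scaleD D T))%N) ->
  limn_einf (fun n : nat => ((n%:R * \prod_(i < d) distZ (n%:R * a i))%:E)) = 0%E.
Proof.
move=> d2 [M DM] _ [eps eps0 epsD] unbounded; apply: contrapT => lim0.
have [|c [N [c0 cN]]] := limn_einf_gt0 _ lim0.
  by move=> n; rewrite mulr_ge0// prodr_ge0// => i _; apply: distZ_ge0.
have c'0 : 0 < c / N.+1%:R ^+ d.+1 by rewrite divr_gt0// exprn_gt0// ltr0n.
have [B GB] := Gaps_bounded (ltnW d2) c'0 (badly_approx_of_eventually c0 cN) DM eps0 epsD.
have [T [T1 BT]] := unbounded B.+1.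
by have := leq_trans BT (GB T T1); rewrite ltnn.
Qed.
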